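(* Let $X$ be a locally compact Hadamard space of rank one such that $X(\infty)$ contains at least three points, and let $G$ be a countable group of isometries of $X$ satisfying the duality condition. Let $x \in X$ be a basepoint, and $\mu$ a probability measure on $G$ whose support generates $G$ as a semigroup, and with finite first moment. Then there exists some $A \geq 0$ such that for $\mathbb{P}$-a.e. sample path there exists a geodesic ray $\gamma : [0, \infty) \to X$ with $\gamma(0) = x$ and $$\lim_{n \to \infty} \frac{d(w_n x, \gamma(An))}{n} = 0.$$
   Context: A metric space $(X,d)$ is a Hadamard space if it is simply connected, complete, geodesic and CAT(0). Geodesic rays and geodesics (lines) are isometric embeddings of $[0,\infty)$ and $\mathbb{R}$ into $X$. The boundary is $X(\infty) := \{\sigma:[0,\infty)\to X \text{ geodesic ray}\}/\sim$, where $\sigma_1\sim\sigma_2$ iff there is $M$ with $d(\sigma_1(t),\sigma_2(t))\le M$ for all $t\ge0$. $X\cup X(\infty)$ carries the usual (cone) topology, which is compact for $X$ locally compact, and isometries of $X$ extend to homeomorphisms of it. For a geodesic $\sigma:\mathbb{R}\to X$, $\sigma(\pm\infty)\in X(\infty)$ are its endpoints. A geodesic $\sigma:\mathbb{R}\to X$ is regular if it does not bound a flat half plane. A locally compact Hadamard space is of rank one if there is at least one regular geodesic. Points $\xi,\eta\in X(\infty)$ are dual if there is a sequence $g_n\in G$ such that, for some $x\in X$, $g_nx\to\xi$ and $g_n^{-1}x\to\eta$. $G$ satisfies the duality condition if for any geodesic $\sigma$ the endpoints $\sigma(-\infty)$ and $\sigma(\infty)$ are dual. Random walk: $\mathbb{P}=\mu^{\mathbb{N}}$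 is the product measure on sequences $(g_1,g_2,\dots)\in G^{\mathbb{N}}$, $w_n := g_1\cdots g_n$. Finite first moment: $\int_G d(x,gx)\,d\mu(g)<\infty$ for some $x\in X$. *)

(* Defs.v *)
From HB Require Import structures.
From mathcomp Require Import all_boot all_order all_algebra.
From mathcomp Require Import all_classical all_reals all_analysis.

Set Implicit Arguments.
Unset Strict Implicit.
Unset Printing Implicit Defensive.

Import Order.TTheory GRing.Theory Num.Theory.
Import numFieldNormedType.Exports.

Local Open Scope classical_set_scope.
Local Open Scope ring_scope.
Local Open Scope quotient_scope.

Section Geodesics.
Context {R : realType} {X : metricType R}.
Implicit Types (p q : X) (f c : R -> X).

Definition isometric_on (D : set R) f :=
  forall s t, D s -> D t -> mdist (f s) (f t) = `|s - t|.

Definition is_segment p q f :=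
  [/\ isometric_on `[0, mdist p q] f, f 0 = p & f (mdist p q) = q].

End Geodesics.

(* A ray is a total function on R of which only the values on [0, +oo[ are
   meaningful; the values at negative times are junk, and they are forgotten in
   the boundary because asymptoticity only compares nonnegative times. *)
Record ray {R : realType} (X : metricType R) := Ray {
  ray_fun :> R -> X;
  ray_isometric : isometric_on `[0, +oo[ ray_fun }.

Record line {R : realType} (X : metricType R) := Line {
  line_fun :> R -> X;
  line_isometric : isometric_on [set: R] line_fun }.

Section HadamardSpaces.
Context {R : realType}.

Definition euclid_dist (a b : R * R) : R :=
  Num.sqrt ((a.1 - b.1) ^+ 2 + (a.2 - b.2) ^+ 2).

Variable X : metricType R.

Definition geodesic_space := forall p q : X, exists f, is_segment p q f.

(* x' is the point at distance s from a on the Euclidean segment [a, b] *)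
Definition euclid_point_on (a b : R * R) (s : R) (x' : R * R) :=
  euclid_dist a x' = s /\ euclid_dist x' b = euclid_dist a b - s.

(* The triangle has vertices v 0, v 1, v 2 and sides c i from v i to v (i + 1),
   indices being taken modulo 3. *)
Definition CAT0 :=
  forall (v : 'I_3 -> X) (c : 'I_3 -> R -> X) (v' : 'I_3 -> R * R),
  (forall i, is_segment (v i) (v (i + 1)) (c i)) ->
  (forall i j, euclid_dist (v' i) (v' j) = mdist (v i) (v j)) ->
  forall (i j : 'I_3) (s t : R) (x' y' : R * R),
  0 <= s <= mdist (v i) (v (i + 1)) -> 0 <= t <= mdist (v j) (v (j + 1)) ->
  euclid_point_on (v' i) (v' (i + 1)) s x' ->
  euclid_point_on (v' j) (v' (j + 1)) t y' ->
  mdist (c i s) (c j t) <= euclid_dist x' y'.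

Definition metrically_complete :=
  forall F : set_system X, ProperFilter F -> cauchy F -> exists l : X, F --> l.

Definition path_connected := forall p q : X, exists f : R -> X,
  [/\ {within `[0, 1], continuous f}, f 0 = p & f 1 = q].

Definition loops_contractible := forall f : R -> X,
  {within `[0, 1], continuous f} -> f 0 = f 1 ->
  exists H : R * R -> X,
  [/\ {within `[0, 1] `*` `[0, 1], continuous H},
      forall t : R, t \in `[0, 1] -> H (0, t) = f t,
      forall t : R, t \in `[0, 1] -> H (1, t) = f 0 &
      forall s : R, s \in `[0, 1] -> H (s, 0) = f 0 /\ H (s, 1) = f 0].

Definition simply_connected := path_connected /\ loops_contractible.

Definition hadamard :=
  [/\ simply_connected, metrically_complete, geodesic_space & CAT0].

Definition bounds_flat_half_plane (sigma : line X) :=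
  exists F : R * R -> X,
    (forall a b : R * R, 0 <= a.2 -> 0 <= b.2 ->
       mdist (F a) (F b) = euclid_dist a b) /\
    (forall s, F (s, 0) = sigma s).

Definition regular_line (sigma : line X) := ~ bounds_flat_half_plane sigma.

Definition rank_one := exists sigma : line X, regular_line sigma.

End HadamardSpaces.

Section Boundary.
Context {R : realType} (X : metricType R).

HB.instance Definition _ := gen_eqMixin (ray X).
HB.instance Definition _ := gen_choiceMixin (ray X).

Definition asymptotic (c1 c2 : ray X) : bool :=
  `[< exists M : R, forall t, 0 <= t -> mdist (c1 t) (c2 t) <= M >].

Lemma asymptotic_refl : reflexive asymptotic.
Proof. by move=> c; apply/asboolP; exists 0 => t _; rewrite mdistxx. Qed.

Lemma asymptotic_sym : symmetric asymptotic.
Proof.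
by move=> c1 c2; apply: asbool_equiv_eq; split => -[M cM];
  exists M => t t0; rewrite metric_sym cM.
Qed.

Lemma asymptotic_trans : transitive asymptotic.
Proof.
move=> c2 c1 c3 /asboolP[M cM] /asboolP[N cN]; apply/asboolP.
exists (M + N) => t t0; apply: le_trans (metric_triangle _ (c2 t) _) _.
by rewrite lerD ?cM ?cN.
Qed.

Canonical asymptotic_equiv :=
  EquivRel asymptotic asymptotic_refl asymptotic_sym asymptotic_trans.

Definition boundary := {eq_quot asymptotic}.

HB.instance Definition _ := Choice.on boundary.
HB.instance Definition _ := EqQuotient.on boundary.

Definition ray_end (c : ray X) : boundary := \pi_boundary c.

Lemma line_ray_subproof (sigma : line X) : isometric_on `[0, +oo[ sigma.
Proof. by move=> s t _ _; exact: line_isometric. Qed.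

Lemma line_rev_subproof (sigma : line X) :
  isometric_on `[0, +oo[ (fun t => sigma (- t)).
Proof.
by move=> s t _ _; rewrite line_isometric// -opprD normrN.
Qed.

Definition line_pinfty (sigma : line X) : boundary :=
  ray_end (Ray (line_ray_subproof sigma)).

Definition line_ninfty (sigma : line X) : boundary :=
  ray_end (Ray (line_rev_subproof sigma)).

Variant bordification := Inner of X | AtInfinity of boundary.

HB.instance Definition _ := gen_eqMixin bordification.
HB.instance Definition _ := gen_choiceMixin bordification.

(* With p_r the projection onto the closed r-ball around c 0, this is the set of
   the z whose distance to c 0 is greater than r and such that p_r z is at
   distance less than e from c r. In a Hadamard space the segment (resp. the ray)
   from c 0 to z is unique, p_r z being its point at time r. *)
Definition cone_nbhd (c : ray X) (r e : R) : set bordification :=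
  [set z | match z with
           | Inner y => r < mdist (c 0) y /\
               exists2 f, is_segment (c 0) y f & mdist (f r) (c r) < e
           | AtInfinity xi => exists c' : ray X,
               [/\ c' 0 = c 0, ray_end c' = xi & mdist (c' r) (c r) < e]
           end].

Definition cone_subbase : set (set bordification) :=
  [set U | (exists (y : X) (e : R), 0 < e /\ U = Inner @` ball y e) \/
           (exists (c : ray X) (r e : R),
              [/\ 0 < r, 0 < e & U = cone_nbhd c r e])].

(* In a Hadamard space the sets of cone_subbase with c issuing from a fixed
   basepoint are a basis of the cone topology, which is independent of the
   basepoint, so that all the basepoints can be used at once. *)
HB.instance Definition _ :=
  isSubBaseTopological.Build bordification cone_subbase id.

End Boundary.

Section Isometries.
Context {R : realType} (X : metricType R).

Record isometry := Isometry {
  isometry_fun :> X -> X;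
  isometry_inv : X -> X;
  isometry_funK : cancel isometry_fun isometry_inv;
  isometry_invK : cancel isometry_inv isometry_fun;
  isometry_mdist : forall y z, mdist (isometry_fun y) (isometry_fun z) = mdist y z }.

HB.instance Definition _ := gen_eqMixin isometry.
HB.instance Definition _ := gen_choiceMixin isometry.

Lemma isometryP (g h : isometry) : g =1 h -> g = h.
Proof.
case: g h => [g g' gK g'K gd] [h h' hK h'K hd] /= /funext gh.
subst h; have gh' : g' = h' by apply/funext => y; rewrite -{1}(h'K y) gK.
by subst h'; congr Isometry; exact: Prop_irrelevance.
Qed.

Definition isometry_one : isometry :=
  @Isometry id id (fun=> erefl) (fun=> erefl) (fun _ _ => erefl).

Lemma isometry_mul_dist (g h : isometry) y z :
  mdist ((g \o h) y) ((g \o h) z) = mdist y z.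
Proof. by rewrite /= !isometry_mdist. Qed.

Definition isometry_mul (g h : isometry) : isometry :=
  Isometry (can_comp (@isometry_funK g) (@isometry_funK h))
           (can_comp (@isometry_invK h) (@isometry_invK g))
           (isometry_mul_dist g h).

Lemma isometry_inv_dist (g : isometry) y z :
  mdist (isometry_inv g y) (isometry_inv g z) = mdist y z.
Proof. by rewrite -(isometry_mdist g) !isometry_invK. Qed.

Definition isometry_opp (g : isometry) : isometry :=
  Isometry (@isometry_invK g) (@isometry_funK g) (isometry_inv_dist g).

Lemma isometry_mulA : associative isometry_mul.
Proof. by move=> f g h; exact: isometryP. Qed.

Lemma isometry_mul1g : left_id isometry_one isometry_mul.
Proof. by move=> g; exact: isometryP. Qed.

Lemma isometry_mulg1 : right_id isometry_one isometry_mul.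
Proof. by move=> g; exact: isometryP. Qed.

Lemma isometry_mulVg : left_inverse isometry_one isometry_opp isometry_mul.
Proof. by move=> g; apply: isometryP => y /=; rewrite isometry_funK. Qed.

Lemma isometry_mulgV : right_inverse isometry_one isometry_opp isometry_mul.
Proof. by move=> g; apply: isometryP => y /=; rewrite isometry_invK. Qed.

HB.instance Definition _ := isGroup.Build isometry
  isometry_mulA isometry_mul1g isometry_mulg1 isometry_mulVg isometry_mulgV.

Record isometry_group := IsometryGroup {
  isometries : set isometry;
  isometries1 : isometries 1%g;
  isometriesM : forall g h, isometries g -> isometries h -> isometries (g * h)%g;
  isometriesV : forall g, isometries g -> isometries g^-1%g }.

Variable G : isometry_group.

Definition dual_points (xi eta : boundary X) :=
  exists2 g : nat -> isometry, (forall n, isometries G (g n)) &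
  exists y : X,
    Inner (g n y) @[n --> \oo] --> AtInfinity xi /\
    Inner ((g n)^-1%g y) @[n --> \oo] --> AtInfinity eta.

Definition duality_condition :=
  forall sigma : line X, dual_points (line_ninfty sigma) (line_pinfty sigma).

Definition gelt := set_type (isometries G).

HB.instance Definition _ := Choice.on gelt.
HB.instance Definition _ := isPointed.Build gelt (SigSub (mem_set (isometries1 G))).
(* the sigma-algebra of all subsets, as befits a countable group *)
HB.instance Definition _ := @isMeasurable.Build default_measure_display
  gelt discrete_measurable discrete_measurable0
  discrete_measurableC discrete_measurableU.

End Isometries.

Section SequenceSpace.
Context d (T : measurableType d).

Definition coordinate_cylinders : set (set (nat -> T)) :=
  [set C | exists (n : nat) (A : set T),
     measurable A /\ C = [set omega : nat -> T | A (omega n)]].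

Definition path_space := g_sigma_algebraType coordinate_cylinders.

Context {R : realType}.

(* P is the product measure mu^N: its values on the cylinders over finitely many
   coordinates, a pi-system generating the sigma-algebra of path_space, determine
   it uniquely. *)
Definition is_product_measure (mu : probability T R)
    (P : probability path_space R) :=
  forall (n : nat) (A : 'I_n -> set T), (forall i, measurable (A i)) ->
  P [set omega : nat -> T | forall i : 'I_n, A i (omega i)] =
    (\prod_(i < n) mu (A i))%E.

End SequenceSpace.

Section RandomWalk.
Context {R : realType} {X : metricType R} {G : isometry_group X}.
Variable mu : probability (gelt G) R.

Definition msupport : set (gelt G) := [set g | 0 < mu [set g]]%E.

Definition support_generates_semigroup :=
  forall g : gelt G, exists s : seq (gelt G),
    [/\ s != [::], {in s, forall h, msupport h} &
        \val g = (\prod_(h <- s) \val h)%g].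

Definition finite_first_moment :=
  exists y : X, (\int[mu]_g (mdist y (\val g y))%:E < +oo)%E.

(* Times are shifted by one: omega i is the increment g_(i+1). *)
Definition walk (omega : nat -> gelt G) (n : nat) : isometry X :=
  (\prod_(i < n) \val (omega i))%g.

End RandomWalk.

(* Main.v *)
Require Import Defs.
From mathcomp Require Import all_boot all_order all_algebra.
From mathcomp Require Import all_classical all_reals all_analysis.
From mathcomp Require Import measurable_realfun.
From mathcomp Require Import ring lra zify.

(* The theorem holds for any complete CAT(0) space containing a line, following
   Karlsson and Margulis. Write a(n) = d(x, w_n x) and let A be the infimum of
   E a(n) / n. A maximal inequality shows that for every e > 0, almost surely,
   a(n) <= (A + e) n eventually, and for infinitely many n
   a(n) - d(w_k x, w_n x) >= (A - e) k for all k between a constant and n. By the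
   Bruhat-Tits inequality w_k x is then within O(sqrt e) k of the point at
   distance about A k on the segment from x to w_n x, so if A > 0 these segments
   converge, as e tends to 0, to a ray tracked sublinearly by the walk. If A = 0,
   the upper bound says that any ray issuing from x will do. *)

Set Implicit Arguments.
Unset Strict Implicit.
Unset Printing Implicit Defensive.

Import Order.TTheory GRing.Theory Num.Theory.
Import numFieldNormedType.Exports.

Local Open Scope classical_set_scope.
Local Open Scope ring_scope.

(** * Geometry of CAT(0) spaces *)

(** The maximal inequality only yields an event of positive probability. Ergodicity of the shift
    upgrades it: almost surely some shift of the path lies in the event, and both bounds survive a
    shift by a fixed time, because the resulting constant error is eventually below e k. The
    inequality serves twice. The process a(n) - (A - e) n is subadditive with mean at least e n,
    since A is an infimum; it gives the lower bound. The additive process summing (A + e) m - a(m)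
    over consecutive blocks of length m, where m is chosen with E a(m) < (A + e) m, gives the upper
    bound. In the geometric part the square root comes from (A + e)^2 - (A - e)^2 = 4 A e, since
    Bruhat-Tits controls squares of distances. A stage of precision delta uses the time (A - delta)
    k on a segment and so asks for delta < A, which is why A = 0 is treated apart. *)

Section HadamardGeometry.
Context {R : realType} {X : metricType R}.
Implicit Types (p q x z : X) (c : R -> X).

Lemma is_segment_sub p q c T : is_segment p q c -> 0 <= T <= mdist p q ->
  is_segment p (c T) c.
Proof.
move=> [ci c0 c1] /andP[T0 TL].
have dT : mdist p (c T) = T.
  rewrite -c0 ci/= ?in_itv/= ?lexx ?T0 ?TL ?mdist_ge0//.
  by rewrite sub0r normrN ger0_norm.
split; rewrite ?dT// => s t /=; rewrite !in_itv/= => /andP[s0 sT] /andP[t0 tT].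
by apply: ci; rewrite /= in_itv/=; apply/andP; split => //; apply: le_trans TL.
Qed.

Lemma is_segment_dist p q c s t : is_segment p q c ->
  0 <= s <= mdist p q -> 0 <= t <= mdist p q -> mdist (c s) (c t) = `|s - t|.
Proof. by move=> [ci _ _] hs ht; apply: ci; rewrite /= in_itv. Qed.

Lemma euclid_distE (a b : R * R) :
  euclid_dist a b ^+ 2 = (a.1 - b.1) ^+ 2 + (a.2 - b.2) ^+ 2.
Proof. by rewrite /euclid_dist sqr_sqrtr// addr_ge0 ?sqr_ge0. Qed.

Lemma euclid_dist_eq (a b : R * R) (r : R) : 0 <= r ->
  (a.1 - b.1) ^+ 2 + (a.2 - b.2) ^+ 2 = r ^+ 2 -> euclid_dist a b = r.
Proof. by move=> r0; rewrite /euclid_dist => ->; rewrite sqrtr_sqr ger0_norm. Qed.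

(* [(u, v)] completes [(0, 0)] and [(L, 0)] to the Euclidean comparison triangle. *)
Lemma comparison_apex (a b L : R) : 0 < L -> 0 <= a -> 0 <= b ->
  L <= a + b -> a <= L + b -> b <= L + a ->
  exists u v : R, u ^+ 2 + v ^+ 2 = a ^+ 2 /\ (L - u) ^+ 2 + v ^+ 2 = b ^+ 2.
Proof.
move=> L0 a0 b0 h1 h2 h3.
pose u := (a ^+ 2 + L ^+ 2 - b ^+ 2) / (2 * L).
have uE : 2 * L * u = a ^+ 2 + L ^+ 2 - b ^+ 2.
  by rewrite /u mulrC divfK// mulf_neq0 ?pnatr_eq0// gt_eqF.
have h : u ^+ 2 <= a ^+ 2.
  have : `|u| <= a.
    rewrite ler_norml; apply/andP; split.
      rewrite -(ler_pM2l (_ : 0 < 2 * L)) ?uE; last by lra.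
      have : 0 <= (a + L - b) * (a + L + b) by apply: mulr_ge0; lra.
      by nra.
    rewrite -(ler_pM2l (_ : 0 < 2 * L)) ?uE; last by lra.
    have : 0 <= (b + a - L) * (b - a + L) by apply: mulr_ge0; lra.
    by nra.
  by move=> ua; rewrite -[u ^+ 2]real_normK ?num_real// lerXn2r// nnegrE.
exists u, (Num.sqrt (a ^+ 2 - u ^+ 2)).
rewrite sqr_sqrtr ?subr_ge0//; split; first by rewrite addrC subrK.
by lra.
Qed.

(* Bruhat-Tits inequality, multiplied by the length of the segment so as to
   cover degenerate segments. *)
Lemma CAT0_segment p q z c s : CAT0 X -> geodesic_space X -> is_segment p q c ->
  0 <= s <= mdist p q ->
  mdist p q * mdist z (c s) ^+ 2 <=
  (mdist p q - s) * mdist z p ^+ 2 + s * mdist z q ^+ 2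
  - s * (mdist p q - s) * mdist p q.
Proof.
move=> hC hG cs hs; set L := mdist p q; set a := mdist z p; set b := mdist z q.
have L0 : 0 <= L := mdist_ge0 _ _.
have [L_eq0|Lpos] : L = 0 \/ 0 < L by move: L0; rewrite le_eqVlt => /orP[/eqP|]; auto.
  have s0 : s = 0 by rewrite -/L L_eq0 in hs; lra.
  by rewrite s0 L_eq0 !mul0r subrr mul0r addr0 subr0.
have [c1 c1s] := hG q z; have [c2 c2s] := hG z p.
have [||||||u [v [huv1 huv2]]] := @comparison_apex a b L; rewrite ?mdist_ge0//.
- by rewrite /a /b (metric_sym z p); exact: metric_triangle.
- by rewrite /a /b /L (metric_sym p q) addrC; exact: metric_triangle.
- by rewrite /a /b /L addrC; exact: metric_triangle.
pose V (i : 'I_3) := if i == 0 :> nat then p else if i == 1%N :> nat then q else z.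
pose C (i : 'I_3) := if i == 0 :> nat then c else if i == 1%N :> nat then c1 else c2.
pose V' (i : 'I_3) : R * R := if i == 0 :> nat then (0, 0) else
  if i == 1%N :> nat then (L, 0) else (u, v).
have hV : forall i, is_segment (V i) (V (i + 1)) (C i).
  by case=> -[|[|[|//]]] h; rewrite /V /C /=.
have e01 : euclid_dist (0, 0) (L, 0) = L.
  by apply: euclid_dist_eq => //=; ring.
have e02 : euclid_dist (0, 0) (u, v) = a.
  by apply: euclid_dist_eq; rewrite /= ?mdist_ge0// -huv1; ring.
have e12 : euclid_dist (L, 0) (u, v) = b.
  by apply: euclid_dist_eq; rewrite /= ?mdist_ge0// -huv2; ring.
have esym (m n : R * R) : euclid_dist m n = euclid_dist n m.
  by rewrite /euclid_dist -[(m.1 - _) ^+ 2]sqrrN -[(m.2 - _) ^+ 2]sqrrN !opprB.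
have exx (m : R * R) : euclid_dist m m = 0.
  by apply: euclid_dist_eq => //; ring.
have hV' i j : euclid_dist (V' i) (V' j) = mdist (V i) (V j).
  case: i => -[|[|[|//]]] h; case: j => -[|[|[|//]]] h'; rewrite /V /V' /=
    ?exx ?mdistxx ?e01 ?e02 ?e12 1?esym ?e01 ?e02 ?e12// /a /b /L
    1?metric_sym//.
have [_ c20 _] := c2s.
have Vs : mdist (V 0) (V (0 + 1)) = L by [].
(* The vertex [z] is entered as the point at time 0 of the third side, which runs from [z] to
   [p]. *)
have := hC V C V' hV hV' 0 (Ordinal (isT : (2 < 3)%N)) s 0 (s, 0) (u, v).
rewrite Vs => /(_ hs); rewrite lexx mdist_ge0 => /(_ isT).
have -> : V' 0 = (0, 0) by [].
have -> : V' (0 + 1) = (L, 0) by [].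
have -> : V' (Ordinal (isT : (2 < 3)%N)) = (u, v) by [].
have -> : V' (Ordinal (isT : (2 < 3)%N) + 1) = (0, 0) by [].
have -> : C 0 = c by [].
have -> : C (Ordinal (isT : (2 < 3)%N)) = c2 by [].
have on01 : euclid_point_on (0, 0) (L, 0) s (s, 0).
  by rewrite /euclid_point_on e01; split; apply: euclid_dist_eq; rewrite /= -/L in hs *;
    [lra|ring|lra|ring].
have on20 : euclid_point_on (u, v) (0, 0) 0 (u, v) by split; rewrite ?exx ?subr0.
rewrite c20 => /(_ on01 on20) hd.
have : mdist z (c s) ^+ 2 <= euclid_dist (s, 0) (u, v) ^+ 2.
  by rewrite lerXn2r ?nnegrE ?mdist_ge0 ?sqrtr_ge0// metric_sym.
rewrite euclid_distE /= => h.
have : L * mdist z (c s) ^+ 2 <= L * ((s - u) ^+ 2 + (0 - v) ^+ 2).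
  by rewrite ler_wpM2l.
(* Stewart's theorem in the comparison triangle. *)
have -> : L * ((s - u) ^+ 2 + (0 - v) ^+ 2) =
  (L - s) * (u ^+ 2 + v ^+ 2) + s * ((L - u) ^+ 2 + v ^+ 2) - s * (L - s) * L by ring.
by rewrite huv1 huv2.
Qed.

(** Bruhat-Tits is applied to [c' t] against the segment from [p] to [c T], then to [c T] against
    the segment from [p] to [c' T]. When the two inequalities are chained, all terms cancel except
    the squares of the two sides. *)
Lemma CAT0_convex p q q' c c' t T : CAT0 X -> geodesic_space X ->
  is_segment p q c -> is_segment p q' c' ->
  0 <= t <= T -> T <= mdist p q -> T <= mdist p q' ->
  T * mdist (c t) (c' t) <= t * mdist (c T) (c' T).
Proof.
move=> hC hG cs cs' /andP[t0 tT] Tq Tq'.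
have T0 : 0 <= T := le_trans t0 tT.
have [h h'] : (0 <= T <= mdist p q) /\ (0 <= T <= mdist p q') by rewrite T0 Tq Tq'.
have sT := is_segment_sub cs h; have sT' := is_segment_sub cs' h'.
have [_ c0 _] := cs; have [_ c0' _] := cs'.
have pT : mdist p (c T) = T.
  by rewrite -{1}c0 (is_segment_dist cs) ?mdist_ge0 ?lexx//; rewrite sub0r normrN ger0_norm.
have pT' : mdist p (c' T) = T.
  by rewrite -{1}c0' (is_segment_dist cs') ?mdist_ge0 ?lexx//; rewrite sub0r normrN ger0_norm.
have pt' : mdist (c' t) p = t.
  rewrite metric_sym -{1}c0' (is_segment_dist cs') ?mdist_ge0 ?lexx// ?t0 ?(le_trans tT)//.
  by rewrite sub0r normrN ger0_norm.
have := @CAT0_segment _ _ (c' t) _ t hC hG sT.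
rewrite pT t0 tT pt' => /(_ isT) h1.
have := @CAT0_segment _ _ (c T) _ t hC hG sT'.
rewrite pT' t0 tT (metric_sym (c T) p) pT => /(_ isT) h2.
rewrite -ler_sqr ?nnegrE ?mulr_ge0 ?mdist_ge0// !exprMn.
rewrite (metric_sym (c t)) in h1 *.
rewrite metric_sym in h2.
have {}h1 := ler_wpM2l T0 h1; have {}h2 := ler_wpM2l t0 h2.
rewrite [X in _ <= X](_ : _ =
  T * ((T - t) * t ^+ 2) + t * ((T - t) * T ^+ 2 +
    t * mdist (c T) (c' T) ^+ 2 - t * (T - t) * T) - T * (t * (T - t) * T)); last by ring.
by lra.
Qed.

End HadamardGeometry.

(** * Sublinear tracking of a sequence by a geodesic ray *)

Section Tracking.
Context {R : realType} {X : metricType R}.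
Implicit Types (p q x z : X) (c : R -> X).

Lemma metrically_complete_seq (u : nat -> X) : metrically_complete X ->
  (forall e : R, 0 < e -> exists N, forall n, (N <= n)%N -> mdist (u N) (u n) < e) ->
  exists l, forall e : R, 0 < e -> exists N, forall n, (N <= n)%N -> mdist (u n) l < e.
Proof.
move=> hc hu; have [|l ul] := hc (u @ \oo).
  apply: cauchy_exP => e e0; have [N hN] := hu e e0.
  exists (u N); exists N => // n /= Nn.
  by rewrite ballEmdist; apply: hN.
exists l => e e0.
have /ul [N _ hN] : nbhs l (ball l e) by exact: nbhsx_ballx.
exists N => n Nn; have := hN n Nn.
by rewrite /= ballEmdist /= metric_sym.
Qed.

(** With s = (A - e) k and L the length of the segment, the hypotheses give d(x, y k) <= (A + e) k
    and d(y k, y n) <= L - s, so by Bruhat-Tits the squared distance from [y k] to the point at time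
    s is at most 4 A e k^2, which the choice of [e] makes equal to (delta k)^2. Going back to time
    (A - delta) k costs at most delta k more. [K] is fixed before [N], so the thresholds of all
    stages are known before any time [n] is picked. *)
Lemma sublinear_stage (y : nat -> X) x (A delta : R) :
  CAT0 X -> geodesic_space X ->
  (forall e : R, 0 < e -> exists K, forall k, (K <= k)%N ->
     mdist x (y k) <= (A + e) * k%:R) ->
  (forall e : R, 0 < e -> exists K, forall N, exists2 n, (N <= n)%N &
     forall k, (K <= k <= n)%N ->
       (A - e) * k%:R <= mdist x (y n) - mdist (y k) (y n)) ->
  0 < delta < A ->
  exists K, forall N, exists nc : nat * (R -> X),
    [/\ (N <= nc.1)%N, is_segment x (y nc.1) nc.2 &
     forall k, (K <= k <= nc.1)%N -> (A - delta) * k%:R <= mdist x (y nc.1) /\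
       mdist (y k) (nc.2 ((A - delta) * k%:R)) <= 2 * delta * k%:R].
Proof.
move=> hC hG hup hlow /andP[d0 dA].
have A0 : 0 < A by lra.
pose e := delta ^+ 2 / (4 * A).
have eE : 4 * A * e = delta ^+ 2.
  by rewrite /e mulrC divfK// mulf_neq0 ?pnatr_eq0// gt_eqF.
have e0 : 0 < e by rewrite divr_gt0 ?exprn_gt0// mulr_gt0.
have ed : e < delta.
  rewrite -(ltr_pM2l (_ : 0 < 4 * A)) ?eE; last lra.
  by rewrite expr2 ltr_pM2r//; lra.
have [K1 hK1] := hup e e0; have [K2 hK2] := hlow e e0.
exists (maxn (maxn K1 K2) 1) => N; have [n Nn hn] := hK2 N.
have [c cs] := hG x (y n); exists (n, c); split => //= k.
rewrite !geq_max => /andP[/andP[/andP[K1k K2k] k1] kn].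
have {}hK1 := hK1 k K1k; have {}hn := hn k; rewrite K2k kn in hn.
have {}hn := hn isT.
set L := mdist x (y n) in hn *; set r := k%:R in hK1 hn *.
have r0 : 0 < r by rewrite ltr0n.
set s := (A - e) * r; set s' := (A - delta) * r.
have s'0 : 0 < s' by rewrite mulr_gt0//; lra.
have s's : s' <= s by rewrite ler_pM2r//; lra.
have sL : s <= L by have := mdist_ge0 (y k) (y n); rewrite -/s in hn; lra.
split; first exact: le_trans sL.
have hs : 0 <= s <= L by apply/andP; split => //; lra.
have := CAT0_segment (y k) hC hG cs hs.
rewrite -/L => hB.
have h : mdist (y k) (c s) <= delta * r.
  rewrite -ler_sqr ?nnegrE ?mulr_ge0 ?mdist_ge0 ?(ltW d0) ?(ltW r0)//.
  have L0 : 0 < L by lra.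
  rewrite -(ler_pM2l L0); apply: le_trans hB _.
  have h1 : (L - s) * mdist (y k) x ^+ 2 <= (L - s) * ((A + e) * r) ^+ 2.
    rewrite ler_wpM2l ?subr_ge0// lerXn2r ?nnegrE ?mdist_ge0 1?metric_sym//.
    by rewrite mulr_ge0//; lra.
  have h2 : s * mdist (y k) (y n) ^+ 2 <= s * (L - s) ^+ 2.
    rewrite ler_wpM2l//; first lra.
    by rewrite lerXn2r ?nnegrE ?mdist_ge0//; rewrite -/s in hn; lra.
  apply: le_trans (_ : (L - s) * (4 * A * e * r ^+ 2) <= _).
    rewrite [leRHS](_ : _ = (L - s) * ((A + e) * r) ^+ 2 + s * (L - s) ^+ 2
      - s * (L - s) * L); last by rewrite /s; ring.
    by rewrite lerB// lerD.
  rewrite eE -exprMn ler_wpM2r ?sqr_ge0//; lra.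
have := metric_triangle (y k) (c s) (c s').
rewrite (is_segment_dist cs hs) -/L; last by apply/andP; split; lra.
rewrite ger0_norm ?subr_ge0//.
have : s - s' <= delta * r.
  by rewrite /s /s' -mulrBl ler_pM2r//; lra.
by lra.
Qed.

Lemma half_power_gt0 (i : nat) : 0 < (2^-1 : R) ^+ i.
Proof. by rewrite exprn_gt0// invr_gt0. Qed.

Lemma half_power_small (C e : R) : 0 <= C -> 0 < e ->
  exists I, forall i, (I <= i)%N -> C * 2^-1 ^+ i <= e.
Proof.
move=> C0 e0; have : (2^-1 : R) ^+ n @[n --> \oo] --> (0 : R).
  by apply: cvg_expr; rewrite ger0_norm ?invr_ge0// invf_lt1// ltr1n.
move=> /cvgrPdist_le /(_ (e / (C + 1))) []; first by rewrite divr_gt0//; lra.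
move=> I _ hI; exists I => i Ii; have := hI i Ii.
rewrite sub0r normrN ger0_norm ?(ltW (half_power_gt0 i))//.
rewrite ler_pdivlMr; last lra.
by have := half_power_gt0 i; nra.
Qed.

(* The segments [c i] from [x] to [y (n i)], for stages of precision [d i], agree
   up to a relative error summable in [i], hence converge to a ray. *)
Lemma sublinear_tracking (y : nat -> X) x (A : R) :
  CAT0 X -> geodesic_space X -> metrically_complete X -> 0 < A ->
  (forall e : R, 0 < e -> exists K, forall k, (K <= k)%N ->
     mdist x (y k) <= (A + e) * k%:R) ->
  (forall e : R, 0 < e -> exists K, forall N, exists2 n, (N <= n)%N &
     forall k, (K <= k <= n)%N ->
       (A - e) * k%:R <= mdist x (y n) - mdist (y k) (y n)) ->
  exists gamma : ray X, gamma 0 = x /\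
    mdist (y n) (gamma (A * n%:R)) / n%:R @[n --> \oo] --> (0 : R).
Proof.
move=> hC hG hcompl A0 hup hlow.
pose h i : R := 2^-1 ^+ i; have h0 i : 0 < h i := half_power_gt0 i.
have hS i : h i.+1 = 2^-1 * h i := exprS _ _.
have h1 i : h i <= 1.
  by elim: i => [|i IH]; rewrite ?hS /h ?expr0// -/(h i); have := h0 i; lra.
(* The factor [A / 2] keeps [A - d i] at least [A / 2], so that the times [(A - d i) * k%:R] stay
   comparable to [k]. *)
pose d i : R := A / 2 * h i.
have d0 i : 0 < d i by rewrite mulr_gt0// divr_gt0.
have dA i : d i <= A / 2 by rewrite ler_piMr// divr_ge0// ltW.
have dS i : d i.+1 = 2^-1 * d i by rewrite /d hS; ring.
have dlt i : 0 < d i < A by have := d0 i; have := dA i; lra.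
have /choice[K hK] := fun i => sublinear_stage hC hG hup hlow (dlt i).
(* Both [K i] and [K i.+1] end up below [n i], so that [y (n i)] is close to [c i] and to [c i.+1];
   this is what compares consecutive segments. [N] stands for the previous time and makes [n]
   increasing. *)
pose req (i N : nat) := (K i + K i.+1 + i + 1 + N)%N.
have /choice[f hf] := fun iN : nat * nat => hK iN.1 (req iN.1 iN.2).
pose fix g i := f (i, if i is j.+1 then (g j).1 else 0%N).
pose n i := (g i).1; pose c i := (g i).2.
have gP i : exists2 N, (if i is j.+1 then n j else 0%N) = N & g i = f (i, N).
  by case: i => [|i]; [exists 0%N|exists (n i)].
have nreq i : (req i (if i is j.+1 then n j else 0%N) <= n i)%N.
  by have [N -> gE] := gP i; rewrite /n gE; case: (hf (i, N)).
have Kn i : (K i <= n i)%N by have := nreq i; rewrite /req; lia.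
have KSn i : (K i.+1 <= n i)%N by have := nreq i; rewrite /req; lia.
have n1 i : (0 < n i)%N by have := nreq i; rewrite /req; lia.
have ni i : (i <= n i)%N by have := nreq i; rewrite /req; lia.
have nS i : (n i <= n i.+1)%N by have := nreq i.+1; rewrite /req; lia.
have cs i : is_segment x (y (n i)) (c i).
  by have [N _ gE] := gP i; rewrite /n /c gE; case: (hf (i, N)).
have ck i k : (K i <= k <= n i)%N -> (A - d i) * k%:R <= mdist x (y (n i)) /\
    mdist (y k) (c i ((A - d i) * k%:R)) <= 2 * d i * k%:R.
  by have [N _ gE] := gP i; rewrite /n /c gE; case: (hf (i, N)) => _ _; exact.
pose T i := (A - d i) * (n i)%:R.
have nR i : 0 < (n i)%:R :> R by rewrite ltr0n.
have T0 i : 0 < T i by rewrite mulr_gt0//; have := dA i; lra.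
have TL i : T i <= mdist x (y (n i)) by case: (ck i (n i)); rewrite ?Kn ?leqnn.
have TS i : T i <= T i.+1.
  apply: ler_pM; rewrite ?ler_nat//; first by have := dA i; lra.
  by rewrite dS; have := d0 i; lra.
have TLS i : T i <= mdist x (y (n i.+1)) := le_trans (TS i) (TL _).
(* By convexity it is enough to compare at time [T i], where both segments are close to [y (n i)].
   The detour costs 2 + 1 + 1/2 times [d i * (n i)%:R], rounded up to 5, and [A / 2 * (n i)%:R] is
   at most [T i]. *)
have step i t : 0 <= t <= T i -> mdist (c i t) (c i.+1 t) <= 5 * h i * t.
  move=> /andP[t0 tT].
  have hT : mdist (c i (T i)) (c i.+1 (T i)) <= 5 * h i * T i.
    have [_ hi] := ck i (n i) (introT andP (conj (Kn i) (leqnn _))).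
    have [hL hi'] := ck i.+1 (n i) (introT andP (conj (KSn i) (nS i))).
    have e1 := metric_triangle (c i (T i)) (y (n i)) (c i.+1 (T i)).
    have e2 := metric_triangle (y (n i)) (c i.+1 ((A - d i.+1) * (n i)%:R)) (c i.+1 (T i)).
    have le1 : T i <= (A - d i.+1) * (n i)%:R.
      by rewrite ler_pM2r// dS; have := d0 i; lra.
    have e3 : mdist (c i.+1 ((A - d i.+1) * (n i)%:R)) (c i.+1 (T i)) =
        (d i - d i.+1) * (n i)%:R.
      rewrite (is_segment_dist (cs i.+1)).
      - by rewrite ger0_norm ?subr_ge0// /T -mulrBl; congr (_ * _); ring.
      - by rewrite hL andbT; apply: le_trans le1; exact: ltW.
      - by rewrite (ltW (T0 _)) TLS.
    rewrite metric_sym in hi; rewrite -/(T i) in hi.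
    have e4 : 5 * d i * (n i)%:R <= 5 * h i * T i.
      rewrite (_ : 5 * d i * _ = 5 * h i * (A / 2 * (n i)%:R)); last by rewrite /d; ring.
      by rewrite ler_pM2l ?mulr_gt0// ler_pM2r//; have := dA i; lra.
    rewrite dS in e2 e3 hi'.
    have := mulr_ge0 (ltW (d0 i)) (ltW (nR i)).
    move: e1 e2; rewrite e3; lra.
  have htT : 0 <= t <= T i by rewrite t0.
  have := CAT0_convex hC hG (cs i) (cs i.+1) htT (TL i) (TLS i).
  move=> hcv; rewrite -(ler_pM2l (T0 i)); apply: le_trans hcv _.
  by rewrite (_ : T i * _ = t * (5 * h i * T i)); [rewrite ler_wpM2l|ring].
have Tmono i j : T i <= T (i + j)%N.
  by elim: j => [|j IH]; rewrite ?addn0// addnS (le_trans IH).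
(* The bounds of [step] telescope, since [h i] is twice [h i - h i.+1]. *)
have far i j t : 0 <= t <= T i ->
    mdist (c i t) (c (i + j)%N t) <= 10 * (h i - h (i + j)%N) * t.
  move=> /andP[t0 tT]; elim: j => [|j IH].
    by rewrite addn0 mdistxx subrr mulr0 mul0r.
  have := step (i + j)%N t; rewrite t0 (le_trans tT)// => /(_ isT).
  have := metric_triangle (c i t) (c (i + j)%N t) (c (i + j).+1 t).
  rewrite addnS hS; lra.
have far' i j t : 0 <= t <= T i -> mdist (c i t) (c (i + j)%N t) <= 10 * h i * t.
  move=> ht; apply: le_trans (far i j t ht) _.
  have := h0 (i + j)%N; case/andP: ht => t0 _ hij.
  by apply: ler_wpM2r => //; lra.
have Tbig t : exists i, forall j, (i <= j)%N -> t <= T j.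
  have [i ti] : exists i : nat, t / (A / 2) <= i%:R.
    exists (Num.truncn `|t / (A / 2)|).+1.
    by apply: le_trans (ler_norm _) (ltW _); exact: truncnS_gt.
  exists i => j ij; apply: le_trans (_ : A / 2 * i%:R <= _).
    by rewrite mulrC -ler_pdivrMr// divr_gt0.
  apply: ler_pM; rewrite ?ler_nat ?divr_ge0 ?(ltW A0)//; last exact: leq_trans (ni j).
  by have := dA j; lra.
(* The value [x] at negative times is junk. *)
have /choice[gam hgam] : forall t : R, exists l, 0 <= t ->
    forall e : R, 0 < e -> exists N, forall m, (N <= m)%N -> mdist (c m t) l < e.
  move=> t; case: (leP 0 t) => [t0|tneg]; last by exists x.
  have [|l hl] := @metrically_complete_seq (fun m => c m t) hcompl; last by exists l.
  move=> e e0; have [I1 hI1] := Tbig t.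
  have [||I2 hI2] := @half_power_small (10 * t) (e / 2); [lra|lra|].
  exists (maxn I1 I2) => m Im.
  have := @far' (maxn I1 I2) (m - maxn I1 I2)%N t; rewrite subnKC//.
  rewrite t0 hI1 ?leq_maxl// => /(_ isT) hh.
  have := hI2 _ (leq_maxr I1 I2); rewrite -/(h _); lra.
have gam_near i t : 0 <= t <= T i -> mdist (c i t) (gam t) <= 10 * h i * t.
  move=> ht; have t0 : 0 <= t by case/andP: ht.
  apply/ler_addgt0Pr => e e0; have [N hN] := hgam t t0 e e0.
  have := metric_triangle (c i t) (c (i + N)%N t) (gam t).
  have := far' i N t ht; have := hN _ (leq_addl i N); lra.
have gam_iso : isometric_on `[0, +oo[ gam.
  move=> s t; rewrite /= !in_itv/= !andbT => s0 t0.
  apply/eqP; rewrite eq_sym -subr_eq0 -normr_le0; apply/ler_addgt0Pr => e e0; rewrite add0r.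
  have [I1 hI1] := Tbig s; have [I2 hI2] := Tbig t.
  have [||I3 hI3] := @half_power_small (10 * (s + t)) e; [lra|lra|].
  pose I := maxn (maxn I1 I2) I3.
  have sI : 0 <= s <= T I by rewrite s0 hI1// /I; lia.
  have tI : 0 <= t <= T I by rewrite t0 hI2// /I; lia.
  have := hI3 I; rewrite -/(h I) leq_maxr => /(_ isT).
  have dst : mdist (c I s) (c I t) = `|s - t|.
    by rewrite (is_segment_dist (cs I))//; move: sI tI; have := TL I; lra.
  have := gam_near I s sI; have := gam_near I t tI.
  have a1 := metric_triangle (c I s) (gam s) (c I t).
  have a2 := metric_triangle (gam s) (gam t) (c I t).
  have a3 := metric_triangle (gam s) (c I s) (gam t).
  have a4 := metric_triangle (c I s) (c I t) (gam t).
  rewrite (metric_sym (gam t) (c I t)) in a2; rewrite (metric_sym (gam s) (c I s)) in a3.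
  rewrite dst in a1 a4.
  by rewrite ler_norml; lra.
exists (Ray gam_iso); split => /=.
  apply/esym/mdist_positivity/eqP; rewrite eq_le mdist_ge0 andbT.
  have [_ c0 _] := cs 0%N; have := gam_near 0%N 0; rewrite c0 mulr0.
  by apply; rewrite lexx ltW.
apply/cvgrPdist_le => e e0.
(* The final detour costs [3 * d i.+1], which is 3/2 of [A * h i.+1], plus 10 times [A * h i.+1],
   all multiplied by [k]; 12 rounds up 23/2. *)
have [||I hI] := @half_power_small (12 * A) e; [lra|lra|].
exists (n I).+1 => // k /= nIk.
have hex : exists i, (k <= n i)%N by exists k; exact: ni.
(* The stage in charge of [k] is the [i.+1] with [n i < k <= n i.+1]; it covers [k] because
   [K i.+1 <= n i]. Stage 0 is excluded by [n 0 <= n I < k]. *)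
case: (ex_minnP hex) => -[|i] ki imin.
  by have : (n 0 <= n I)%N by [elim: (I) => // j IH; exact: leq_trans (nS j)]; lia.
have nik : (n i < k)%N by rewrite ltnNge; apply/negP => /imin; rewrite ltnn.
have Ii : (I <= i.+1)%N.
  rewrite leqNgt; apply/negP => iI.
  have : (n i.+1 <= n I)%N.
    rewrite -(subnKC iI); elim: (I - i.+2)%N => [|j IH]; rewrite ?addn0 ?nS//.
    by rewrite addnS; exact: leq_trans (nS _).
  by lia.
have k0 : 0 < k%:R :> R by rewrite ltr0n; lia.
rewrite sub0r normrN ger0_norm ?divr_ge0 ?mdist_ge0// ler_pdivrMr//.
have [] := ck i.+1 k; first by rewrite ki andbT (leq_trans (KSn i))// ltnW.
set s := (A - d i.+1) * k%:R => hs hyk.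
have s0 : 0 <= s by rewrite mulr_ge0//; have := dA i.+1; lra.
have sT : 0 <= s <= T i.+1.
  by rewrite s0 ler_pM2l ?ler_nat//; have := dA i.+1; lra.
have := gam_near i.+1 s sT => hcg.
have hgg : mdist (gam s) (gam (A * k%:R)) = d i.+1 * k%:R.
  rewrite gam_iso /= ?in_itv/= ?andbT// ?mulr_ge0 ?(ltW A0)//.
  by rewrite /s -mulrBl addrAC subrr sub0r mulNr normrN ger0_norm// mulr_ge0// ltW.
have a1 := metric_triangle (y k) (c i.+1 s) (gam (A * k%:R)).
have a2 := metric_triangle (c i.+1 s) (gam s) (gam (A * k%:R)).
have hsk : 10 * h i.+1 * s <= 10 * h i.+1 * (A * k%:R).
  rewrite ler_pM2l ?mulr_gt0//; rewrite ler_pM2r//.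
  by have := d0 i.+1; lra.
have : 12 * A * h i.+1 * k%:R <= e * k%:R by rewrite ler_pM2r//; exact: hI.
have : 3 * d i.+1 * k%:R = 3 / 2 * (A * h i.+1 * k%:R) by rewrite /d; ring.
have : 0 < A * h i.+1 * k%:R by rewrite !mulr_gt0.
rewrite hgg in a2; lra.
Qed.

End Tracking.

(** The points of the line at integer times satisfy the hypotheses of [sublinear_tracking] at speed
    1: the distance [D] from the basepoint to the line's origin is absorbed into [e * k%:R]. Only
    the origin of the resulting ray is kept. *)
Lemma exists_ray_from (R : realType) (X : metricType R) (x : X) (sigma : line X) :
  CAT0 X -> geodesic_space X -> metrically_complete X ->
  exists gamma : ray X, gamma 0 = x.
Proof.
move=> hC hG hc; pose y (k : nat) := sigma k%:R; pose D := mdist x (y 0%N).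
have D0 : 0 <= D := mdist_ge0 _ _.
have dy (i j : nat) : mdist (y i) (y j) = `|i%:R - j%:R| by exact: line_isometric.
have Dsmall (e : R) : 0 < e -> exists K, forall k, (K <= k)%N -> D <= e * k%:R.
  move=> e0; exists (Num.bound (D / e)) => k Kk.
  rewrite mulrC -ler_pdivrMr// (le_trans (ltW (archi_boundP _))) ?ler_nat//.
  by rewrite divr_ge0// ltW.
have [|e e0|e e0|gamma [g0 _]] := @sublinear_tracking _ _ y x 1 hC hG hc.
- exact: ltr01.
- have [K hK] := Dsmall e e0; exists K => k Kk.
  have := metric_triangle x (y 0%N) (y k); rewrite dy -/D sub0r normrN normr_nat.
  by have := hK k Kk; rewrite mulrDl mul1r; lra.
- have [K hK] := Dsmall e e0; exists K => N; exists N => // k /andP[Kk kN].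
  have := metric_triangle (y 0%N) x (y N); rewrite !dy sub0r normrN normr_nat.
  rewrite (metric_sym (y 0%N)) -/D distrC -natrB// normr_nat natrB//.
  by have := hK k Kk; rewrite mulrBl mul1r; lra.
by exists gamma.
Qed.

(** * The Bernoulli shift *)

Section BernoulliShift.
Context d (T : measurableType d) {R : realType}.
Variables (mu : probability T R) (P : probability (path_space T) R).
Hypothesis muP : is_product_measure mu P.

Definition path_shift (m : nat) (omega : path_space T) : path_space T :=
  fun i => omega (m + i)%N.

Definition cylinder (A : nat -> set T) : set (path_space T) :=
  [set omega | forall i, A i (omega i)].

(** A total sequence of sets, trivial from [n] on, instead of a family over ['I_n]: cylinders of
    different lengths can then be intersected and concatenated pointwise. *)
Definition finite_cylinder (n : nat) (A : nat -> set T) :=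
  (forall i, measurable (A i)) /\ (forall i, (n <= i)%N -> A i = setT).

Definition finite_cylinders : set (set (path_space T)) :=
  [set C | exists n A, finite_cylinder n A /\ C = cylinder A].

Lemma measurable_coordinate i : measurable_fun [set: path_space T] (fun omega => omega i : T).
Proof.
move=> _ A mA; rewrite setTI; apply: sub_sigma_algebra.
by exists i, A.
Qed.

Lemma measurable_cylinder A : (forall i, measurable (A i)) -> measurable (cylinder A).
Proof.
move=> mA; rewrite (_ : cylinder A = \bigcap_i ((fun omega => omega i) @^-1` A i)).
  apply: bigcapT_measurable => i.
  by rewrite -[X in measurable X]setTI; apply: measurable_coordinate.
by apply/seteqP; split => [w h i _|w h i]; [exact: h|exact: (h i)].
Qed.

Lemma finite_cylindersI : setI_closed finite_cylinders.
Proof.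
move=> _ _ [n [A [[mA An] ->]]] [m [B [[mB Bm] ->]]].
exists (maxn n m), (fun i => A i `&` B i); split; first split.
- by move=> i; exact: measurableI.
- by move=> i; rewrite geq_max => /andP[/An -> /Bm ->]; rewrite setTI.
- by apply/seteqP; split => [w [hA hB] i|w h]; [split|split=> i; case: (h i)].
Qed.

Lemma measurable_finite_cylinders :
  @measurable _ (path_space T) = <<s finite_cylinders >>.
Proof.
rewrite /measurable /=; apply/seteqP; split.
  apply: smallest_sub; first exact: smallest_sigma_algebra.
  move=> _ [i [A [mA ->]]]; apply: sub_sigma_algebra.
  exists i.+1, (fun j => if j == i then A else setT); split; first split.
  - by move=> j; case: ifP.
  - by move=> j; case: eqP => // ->; rewrite ltnn.
  - apply/seteqP; split => [w h j|w /(_ i)]; last by rewrite eqxx.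
    by case: eqP => [->|].
apply: smallest_sub; first exact: smallest_sigma_algebra.
by move=> _ [n [A [[mA _] ->]]]; exact: measurable_cylinder.
Qed.

Lemma cylinderT : cylinder (fun=> setT) = setT.
Proof. by apply/seteqP; split. Qed.

Lemma eq_finite_measure (m1 m2 : {measure set (path_space T) -> \bar R}) :
  (m1 setT < +oo)%E ->
  (forall n A, finite_cylinder n A -> m1 (cylinder A) = m2 (cylinder A)) ->
  forall B, measurable B -> m1 B = m2 B.
Proof.
move=> m1oo m12; apply: (measure_unique finite_cylinders (fun=> setT)) => //.
- exact: measurable_finite_cylinders.
- exact: finite_cylindersI.
- by move=> i; exists 0%N, (fun=> setT); rewrite cylinderT; split => //; split.
- by rewrite bigcup_const//; exists 0%N.
- by move=> _ [n [A [hA ->]]]; exact: m12 hA.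
Qed.

Lemma product_measure_cylinder n A : finite_cylinder n A ->
  P (cylinder A) = (\prod_(i < n) mu (A i))%E.
Proof.
move=> [mA An]; rewrite -(muP (A := fun i : 'I_n => A i))//.
congr (P _); apply/seteqP; split => [w h i|w h i]; first exact: h.
by have [ni|ni] := leqP n i; [rewrite An|exact: (h (Ordinal ni))].
Qed.

Lemma measurable_path_shift m : measurable_fun setT (path_shift m).
Proof.
apply: (@measurability _ _ _ (path_space T) _ _ (@coordinate_cylinders _ T)) => // _ [_ [i [A [mA ->]]] <-].
rewrite setTI; apply: sub_sigma_algebra.
by exists (m + i)%N, A.
Qed.

(** Both sides are finite measures in [B]: a pushforward of a restriction of [P], and a multiple of
    [P]. They agree on a cylinder over [C], because the first [m] sets of [A] followed by those of
    [C] define one cylinder, whose probability is a product that splits at [m]. *)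
Lemma path_shift_independent m A B : finite_cylinder m A -> measurable B ->
  P (cylinder A `&` path_shift m @^-1` B) = (P (cylinder A) * P B)%E.
Proof.
move=> hA; have mA : measurable (cylinder A) by case: hA => mA _; exact: measurable_cylinder.
pose r : {nonneg R} := NngNum (fine_ge0 (measure_ge0 P (cylinder A))).
have rE : r%:num%:E = P (cylinder A) by rewrite /= fineK// fin_num_measure.
have mS := measurable_path_shift m.
rewrite setIC -rE -/(mscale r P B) -/(mrestr P mA _) -/(pushforward (mrestr P mA) (path_shift m) B).
apply: eq_finite_measure => [|n C hC].
  by rewrite /= /pushforward /mrestr preimage_setT setTI -ge0_fin_numE// fin_num_measure.
rewrite /= /pushforward /mrestr /mscale /= fineK ?fin_num_measure//.
case: hA => mAi Am; case: hC => mCi Cn.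
pose D i := if (i < m)%N then A i else C (i - m)%N.
have hD : finite_cylinder (m + n) D.
  split=> i; first by rewrite /D; case: ifP.
  by move=> mni; rewrite /D ltnNge (leq_trans (leq_addr _ _) mni)/= Cn// leq_subRL// (leq_trans (leq_addr _ _) mni).
rewrite (_ : _ `&` _ = cylinder D); last first.
  apply/seteqP; split => [w [hC' hA'] i|w hw].
    rewrite /D; case: ltnP => // mi.
    by have := hC' (i - m)%N; rewrite /path_shift subnKC.
  split=> i; first by have := hw (m + i)%N; rewrite /D ltnNge leq_addr/= addKn.
  by have := hw i; rewrite /D; case: ltnP => // mi; rewrite Am.
rewrite (product_measure_cylinder hD) big_split_ord /=.
rewrite (product_measure_cylinder (conj mAi Am)) (product_measure_cylinder (conj mCi Cn)).
congr (_ * _)%E; apply: eq_bigr => i _; rewrite /D /=; first by rewrite ltn_ord.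
by rewrite ltnNge leq_addr/= addKn.
Qed.

Lemma path_shift_preserves m B : measurable B -> P (path_shift m @^-1` B) = P B.
Proof.
move=> mB; have hT : finite_cylinder m (fun=> setT) by split.
by have := path_shift_independent hT mB; rewrite cylinderT setTI probability_setT mul1e.
Qed.

Lemma path_shiftD i j (omega : path_space T) : path_shift i (path_shift j omega) = path_shift (j + i) omega.
Proof. by apply/funext => k; rewrite /path_shift addnA. Qed.

Lemma path_shift0 (omega : path_space T) : path_shift 0 omega = omega.
Proof. by apply/funext => k; rewrite /path_shift. Qed.

(* The set of paths never entering [E] is almost everywhere shift invariant,
   hence independent of every cylinder, and so of itself. *)
Lemma path_shift_ergodic m E : (0 < m)%N -> measurable E -> (0 < P E)%E ->
  {ae P, forall omega, exists j, E (path_shift (j * m) omega)}.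
Proof.
move=> m0 mE PE0.
pose Q := \bigcap_j (path_shift (j * m) @^-1` ~` E).
have mpre k B : measurable B -> measurable (path_shift k @^-1` B).
  by move=> mB; rewrite -[X in measurable X]setTI; exact: measurable_path_shift.
have mQ : measurable Q.
  by apply: bigcapT_measurable => j; apply: mpre; exact: measurableC.
have QS k : Q `<=` path_shift (k * m) @^-1` Q.
  by move=> w hw j _ /=; rewrite path_shiftD -mulnDl; exact: hw.
have QA n A : finite_cylinder n A -> P (cylinder A `&` Q) = (P (cylinder A) * P Q)%E.
  move=> [mA An]; have mcA := measurable_cylinder mA.
  (* A shift by [n * m] passes the [n] coordinates constrained by [A] and is still a multiple of
     [m], as [QS] demands. *)
  have hA' : finite_cylinder (n * m) A.
    by split=> // i nmi; apply: An; apply: leq_trans nmi; rewrite leq_pmulr.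
  rewrite -(path_shift_independent hA' mQ).
  set Q' := _ @^-1` Q; have mQ' : measurable Q' := mpre _ _ mQ.
  have Q'D : P (Q' `\` Q) = 0%E.
    rewrite measureD//; last by rewrite -ge0_fin_numE// fin_num_measure.
    rewrite setIidr; last exact: QS.
    rewrite [X in (X - _)%E](path_shift_preserves (n * m) mQ) subee//.
    by rewrite fin_num_measure.
  apply/eqP; rewrite eq_le; apply/andP; split.
    by apply: le_measure; rewrite ?inE; [exact: measurableI|exact: measurableI|exact: setIS (QS n)].
  rewrite -[leRHS]adde0 -Q'D.
  apply: (@le_trans _ _ (P ((cylinder A `&` Q) `|` (Q' `\` Q)))).
    apply: le_measure; rewrite ?inE; [exact: measurableI| |].
      by apply: measurableU; [exact: measurableI|exact: measurableD].
    by move=> w [cw q'w]; have [qw|nqw] := pselect (Q w); [left|right].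
  by apply: measureU2; [exact: measurableI|exact: measurableD].
have PQQ : P Q = (P Q * P Q)%E.
  rewrite -{1}[Q]setIid.
  pose r : {nonneg R} := NngNum (fine_ge0 (measure_ge0 P Q)).
  have rE : r%:num%:E = P Q by rewrite /= fineK// fin_num_measure.
  rewrite -[X in _ = (X * _)%E]rE -/(mscale r P Q) -/(mrestr P mQ _).
  apply: (eq_finite_measure _ _ mQ) => [|n A hA].
    by rewrite /= /mrestr setTI -ge0_fin_numE// fin_num_measure.
  by rewrite /= /mrestr /mscale /= fineK ?fin_num_measure// (QA _ _ hA) muleC.
exists Q; split => //; last first.
  move=> w /=; rewrite -forallNE => hw j _; exact: hw.
(* The index 0 in [Q] makes it disjoint from [E]. Hence [P Q] is less than 1, and [PQQ] leaves only
   0. *)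
have QE : (P Q + P E <= 1)%E.
  rewrite -measureU//; first exact: probability_le1 (measurableU _ _ mQ mE).
  apply/seteqP; split => // w [/(_ 0%N I) /=]; rewrite mul0n path_shift0; exact.
have : P Q \is a fin_num by rewrite fin_num_measure.
have : P E \is a fin_num by rewrite fin_num_measure.
move: PQQ QE PE0; case: (P Q) => [q||]//; case: (P E) => [e||]//.
rewrite -EFinM -EFinD lte_fin lee_fin => -[qq] qe e0 _ _.
by congr EFin; nra.
Qed.

End BernoulliShift.

(** * The maximal inequality *)

Section MeasurePreserving.
Context d (T : measurableType d) {R : realType} (P : probability T R).
Variable S : T -> T.
Hypothesis mS : measurable_fun [set: T] S.
Hypothesis PS : forall B, measurable B -> P (S @^-1` B) = P B.

Lemma ge0_integral_preserved (h : T -> \bar R) : measurable_fun [set: T] h ->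
  (forall w, (0 <= h w)%E) -> (\int[P]_w h (S w) = \int[P]_w h w)%E.
Proof.
move=> mh h0; rewrite -[LHS](@ge0_integral_pushforward _ _ _ _ _ S mS P setT)//.
by apply: eq_measure_integral => A mA _; exact: PS.
Qed.

Lemma integrable_preserved (h : T -> R) : P.-integrable setT (EFin \o h) ->
  P.-integrable setT (EFin \o (h \o S)).
Proof.
move=> /integrableP[mh hoo]; apply/integrableP; split.
  exact: (measurableT_comp mh mS).
by rewrite (ge0_integral_preserved (h := fun w => `|(h w)%:E|%E))//; exact: measurableT_comp.
Qed.

Lemma Rintegral_preserved (h : T -> R) : P.-integrable setT (EFin \o h) ->
  \int[P]_w h (S w) = \int[P]_w h w.
Proof.
move=> hi; congr fine; have [mh _] := integrableP _ _ _ hi.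
have := @integral_pushforward _ _ _ _ _ S mS P setT (EFin \o h) mh (integrable_preserved hi) measurableT.
rewrite preimage_setT => <-.
by apply: eq_measure_integral => A mA _; rewrite /= /pushforward PS.
Qed.

Lemma measurable_iter k : measurable_fun [set: T] (iter k S).
Proof.
elim: k => [|k IH]; first exact: measurable_id.
exact: (measurableT_comp mS IH).
Qed.

End MeasurePreserving.

Section IterPreserving.
Context d (T : measurableType d) {R : realType} (P : probability T R).
Variable S : T -> T.
Hypothesis mS : measurable_fun [set: T] S.
Hypothesis PS : forall B, measurable B -> P (S @^-1` B) = P B.

Lemma iter_preserves k B : measurable B -> P (iter k S @^-1` B) = P B.
Proof.
elim: k B => [|k IH] B mB //; rewrite -[RHS]PS// -[RHS]IH//.
by rewrite -[X in measurable X]setTI; exact: mS.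
Qed.

Lemma Rintegral_sum_nat (h : nat -> T -> R) n :
  (forall i, P.-integrable setT (EFin \o h i)) ->
  P.-integrable setT (EFin \o (fun w => \sum_(i < n) h i w)) /\
  \int[P]_w (\sum_(i < n) h i w) = \sum_(i < n) \int[P]_w h i w.
Proof.
move=> hi; elim: n => [|n [IH1 IH2]].
  split; last by rewrite big_ord0 /Rintegral (eq_integral (cst 0%E)) ?integral0// => w _; rewrite big_ord0.
  by apply: (eq_integrable measurableT (cst 0%E)) => [w _|]; [rewrite /= big_ord0|exact: integrable0].
split.
  apply: (eq_integrable measurableT
    ((EFin \o (fun w => \sum_(i < n) h i w)%R) \+ (EFin \o h n))%E) => [w _|].
    by rewrite /= big_ord_recr.
  exact: integrableD.
rewrite big_ord_recr /= -IH2 -RintegralD//.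
by apply: eq_Rintegral => w _; rewrite big_ord_recr.
Qed.

Section Leaders.
Variables (b : nat -> T -> R) (f : T -> R).
Hypothesis bi : forall n, P.-integrable setT (EFin \o b n).
Hypothesis fi : P.-integrable setT (EFin \o f).
Hypothesis b0 : forall w, b 0%N w = 0.
Hypothesis bS : forall n w, b n.+1 w <= f w + b n (S w).

(* The times [n] for which Karlsson and Margulis' [b n - b (n - k) o S^k] is
   nonnegative for all [k <= n] at once. *)
Definition leader (n : nat) : set T :=
  [set w | forall k, (k <= n)%N -> b (n - k)%N (iter k S w) <= b n w].

Let g n w : R := \1_(leader n) w * `|f w|.

Let g0 n w : 0 <= g n w.
Proof. by rewrite mulr_ge0// indicE. Qed.

(** At a leader, one step is taken at the cost of [f w]. Otherwise some [k], necessarily positive,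
    has b(n - k) at the k-th iterate larger than b(n), and one jumps there at no cost. So only
    leaders pay; the absolute value in [g] allows the skipped terms to be added back. *)
Lemma leader_bound n w : b n w <= \sum_(k < n) g (n - k) (iter k S w).
Proof.
elim/ltn_ind: n w => -[|n] IH w; first by rewrite big_ord0 b0.
have [lw|nlw] := pselect (leader n.+1 w).
  rewrite big_ord_recl /= subn0 /g indicE mem_set// mul1r.
  apply: le_trans (bS n w) (lerD (ler_norm _) _).
  apply: le_trans (IH n _ (S w)) _ => //.
  apply: ler_sum => i _; rewrite /= /bump/= add1n subSS.
  by rewrite -[S (iter i S w)]/(iter i.+1 S w) -iterSr.
have /existsNP[k /not_implyP[kn /negP]] := nlw; rewrite -ltNge => blt.
case: k => [|k] in kn blt *; first by rewrite subn0 /= ltxx in blt.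
apply: le_trans (ltW blt) _; apply: le_trans (IH _ _ _) _.
  by rewrite subSS ltnS leq_subr.
rewrite -(big_mkord xpredT (fun j => g (n.+1 - k.+1 - j) (iter j S (iter k.+1 S w)))).
rewrite -(big_mkord xpredT (fun j => g (n.+1 - j) (iter j S w))).
rewrite [leRHS](@big_cat_nat _ _ _ k.+1)//.
apply: ler_wpDl; first by apply: sumr_ge0.
rewrite -[k.+1 in leRHS]add0n big_addn; apply: ler_sum => j _.
by rewrite -iterD subnDA subnAC (addnC j).
Qed.

Let measurable_b n : measurable_fun [set: T] (b n).
Proof. by apply/measurable_EFinP; case/integrableP: (bi n). Qed.

Lemma measurable_leader n : measurable (leader n).
Proof.
rewrite (_ : leader n = \bigcap_(k in [set k | (k <= n)%N])
    (setT `&` [set w | b (n - k)%N (iter k S w) <= b n w])).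
  apply: bigcap_measurable => [|k _]; first by exists 0%N.
  apply: measurable_fun_le => //.
  exact: (measurableT_comp (measurable_b _) (measurable_iter mS k)).
by apply/seteqP; split => w hw k kn; [split => //; exact: hw|case: (hw k kn)].
Qed.

Let mf : measurable_fun [set: T] f.
Proof. by apply/measurable_EFinP; case/integrableP: fi. Qed.

Let mg n : measurable_fun [set: T] (g n).
Proof.
apply: measurable_funM; first exact/measurable_indic/measurable_leader.
exact: measurableT_comp.
Qed.

Let gf n w : `|g n w| <= `|f w|.
Proof.
rewrite ger0_norm// /g indicE; case: (_ \in _); rewrite ?mul1r ?mul0r//.
Qed.

Let gi n : P.-integrable setT (EFin \o g n).
Proof.
apply: (le_integrable measurableT _ _ fi); first exact/measurable_EFinP.
by move=> w _ /=; rewrite lee_fin.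
Qed.

(* Integrating [leader_bound], the mean of [b n] is at most a sum of the [n]
   numbers [\int g i]; if leaders occurred finitely often, these would tend
   to 0 by dominated convergence. *)
Lemma leader_io_gt0 (B : R) : 0 < B ->
  (forall n, B * n%:R <= \int[P]_w b n w) -> (0 < P (lim_sup_set leader))%E.
Proof.
move=> B0 hB; rewrite lt_neqAle measure_ge0 andbT; apply/eqP => /esym P0.
pose G n := \int[P]_w g n w.
have Gle n : B * n%:R <= \sum_(i < n) G i.+1.
  apply: le_trans (hB n) _.
  have hi k : P.-integrable setT (EFin \o (fun w => g (n - k) (iter k S w))).
    exact: (integrable_preserved (measurable_iter mS k) (iter_preserves k) (gi _)).
  have [si sE] := Rintegral_sum_nat n hi.
  apply: le_trans (le_Rintegral measurableT (bi n) si _) _ => [w _|].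
    exact: leader_bound.
  (* By invariance the term of index k has mean [G (n - k)]; reversing the order of summation turns
     these into the [G i.+1]. *)
  rewrite sE (reindex_inj rev_ord_inj) /=; apply: ler_sum => i _.
  rewrite (Rintegral_preserved (measurable_iter mS _) (iter_preserves _) (gi _)).
  by rewrite /G subKn.
have G0 : G n @[n --> \oo] --> (0 : R).
  have ae0 : {ae P, forall w, setT w -> (g n w)%:E @[n --> \oo] --> 0%E}.
    exists (lim_sup_set leader); split.
    - apply: bigcapT_measurable => n; apply: bigcup_measurable => k _.
      exact: measurable_leader.
    - exact: P0.
    - move=> w /= nw; apply: contrapT => /existsNP[N /not_implyP[_ hN]].
      apply: nw => _; apply: cvg_near_cst; exists N => // n /= Nn.
      rewrite /g indicE memNset ?mul0r// => lw; apply: hN.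
      by exists n.
  have mge n : measurable_fun [set: T] (EFin \o g n) by exact/measurable_EFinP.
  have gfe : {ae P, forall w n, setT w -> (`|(g n w)%:E| <= `|(f w)%:E|)%E}.
    by apply: aeW => w n _; rewrite lee_fin.
  have [_ _] := @dominated_convergence _ _ _ P setT measurableT (fun n => EFin \o g n) (cst 0%E)
    (fun w => `|(f w)%:E|%E) mge (measurable_cst _) ae0 (integrable_abse fi) gfe.
  rewrite integral0; move=> /fine_cvgP[_]; exact.
(* The means of the [G i.+1] tend to 0, whereas [Gle] keeps them at least [B]; [B / 2] separates the
   two. *)
have := cesaro (u_ := fun n => G n.+1) (l := 0) => /(_ _)/cvgrPdist_le.
move=> /(_ _ (B / 2))[||N _ /(_ N (leqnn _))]; rewrite ?divr_gt0//.
  by have := G0; rewrite -(cvg_shiftS).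
rewrite sub0r normrN /arithmetic_mean /= => hN.
have := Gle N.+1; have := le_trans (ler_norm _) hN.
rewrite ler_pdivrMl ?ltr0n// seriesEord /= => h1 h2.
have := le_trans h2 h1; rewrite mulrC ler_pM2l ?ltr0n//; lra.
Qed.

End Leaders.
End IterPreserving.

(** * The displacement of the walk *)

Section Displacement.
Context {R : realType} {X : metricType R} {G : isometry_group X}.
Variable x : X.
Implicit Types omega : path_space (gelt G).

Lemma iter_path_shift k m omega : iter k (path_shift m) omega = path_shift (k * m) omega.
Proof.
elim: k => [|k IH]; first by rewrite mul0n path_shift0.
by rewrite iterS IH path_shiftD mulSn addnC.
Qed.

Lemma walkD omega m n : walk omega (m + n) = (walk omega m * walk (path_shift m omega) n)%g.
Proof. by rewrite /walk big_split_ord. Qed.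

Lemma walk0 omega : walk omega 0 = 1%g.
Proof. by rewrite /walk big_ord0. Qed.

Lemma walk1 omega : walk omega 1 = \val (omega 0%N).
Proof. by rewrite /walk big_ord1. Qed.

Definition displacement n omega : R := mdist x (walk omega n x).

Lemma displacement_ge0 n omega : 0 <= displacement n omega.
Proof. exact: mdist_ge0. Qed.

Lemma displacement0 omega : displacement 0 omega = 0.
Proof. by rewrite /displacement walk0 mdistxx. Qed.

Lemma mdist_walk m n omega :
  mdist (walk omega m x) (walk omega (m + n) x) = displacement n (path_shift m omega).
Proof. by rewrite walkD isometry_mdist. Qed.

Lemma displacementD m n omega :
  displacement (m + n) omega <= displacement m omega + displacement n (path_shift m omega).
Proof. by rewrite -mdist_walk; exact: metric_triangle. Qed.

Lemma displacement_shift m n omega :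
  displacement n (path_shift m omega) <= displacement m omega + displacement (m + n) omega.
Proof. by rewrite -mdist_walk /displacement (metric_sym x (walk omega m x)); exact: metric_triangle. Qed.

Hypothesis cG : countable (isometries G).

(** The type of isometries carries no sigma-algebra, hence the arbitrary [Y]. Splitting by the last
    increment gives a countable union in which [Y] is translated on the right, so the induction has
    to range over all [Y]. *)
Lemma measurable_walk n (Y : set (Defs.isometry X)) :
  measurable [set omega : path_space (gelt G) | Y (walk omega n)].
Proof.
elim: n Y => [|n IH] Y.
  have [Y1|nY1] := pselect (Y 1%g).
    by rewrite (_ : [set _ | _] = setT)//; apply/seteqP; split => // w _ /=; rewrite walk0.
  by rewrite (_ : [set _ | _] = set0)//; apply/seteqP; split => // w /=; rewrite walk0.
rewrite (_ : [set _ | _] = \bigcup_(g : gelt G)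
    ((fun omega : path_space (gelt G) => omega n) @^-1` [set g] `&`
     [set omega | [set v | Y (v * \val g)%g] (walk omega n)])); last first.
  apply/seteqP; split => [w hw|w [g _ [/= <-]]]; last by rewrite /walk big_ord_recr.
  by exists (w n) => //; split => //; move: hw; rewrite /= /walk big_ord_recr.
apply: countable_bigcupT_measurable => [|g].
  by rewrite (eq_countable (card_setT (isometries G))).
apply: measurableI; last exact: IH.
by rewrite -[X in measurable X]setTI; exact: measurable_coordinate.
Qed.

Lemma measurable_displacement n : measurable_fun [set: path_space (gelt G)] (displacement n).
Proof. by move=> _ Y mY; rewrite setTI; exact: (measurable_walk n [set v | Y (mdist x (v x))]). Qed.

(** * The rate of escape and the almost sure bounds *)

Section Drift.
Variables (mu : probability (gelt G) R) (P : probability (path_space (gelt G)) R).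
Hypothesis muP : is_product_measure mu P.
Hypothesis hmom : finite_first_moment mu.

(** The first increment has law [mu], and the moment at the given point [y] controls the one at [x],
    since d(x, g x) <= 2 d(x, y) + d(y, g y). *)
Lemma integrable_displacement1 : P.-integrable setT (EFin \o displacement 1).
Proof.
apply/integrableP; split.
  by apply/measurable_EFinP; exact: measurable_displacement.
have [y hy] := hmom.
have PM (A : set (gelt G)) :
    P ((fun w : path_space (gelt G) => w 0%N) @^-1` A) = mu A.
  have := muP (n := 1) (A := fun=> A) (fun=> I).
  rewrite big_ord1 => <-; congr (P _); apply/seteqP; split => [w hw i|w hw].
    by rewrite (ord1 i).
  exact: (hw ord0).
pose h (g : gelt G) := `|(mdist x (\val g x))%:E|%E.
rewrite (_ : (fun w => _) = h \o (fun w : path_space (gelt G) => w 0%N)); last first.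
  by apply/funext => w; rewrite /h /= /displacement walk1.
have mh : measurable_fun [set: gelt G] h by [].
have h0 g : (0 <= h g)%E by exact: abse_ge0.
have mc : measurable_fun [set: path_space (gelt G)] (fun w => w 0%N : gelt G).
  exact: measurable_coordinate.
rewrite -[X in (X < _)%E](@ge0_integral_pushforward _ _ _ _ _ _ mc P setT h)//.
rewrite [X in (X < _)%E](_ : _ = \int[mu]_g h g)%E; last first.
  by apply: eq_measure_integral => A mA _; exact: PM.
have md (z : X) : measurable_fun [set: gelt G] (fun g : gelt G => (mdist z (\val g z))%:E) by [].
apply: (@le_lt_trans _ _ (\int[mu]_g ((2 * mdist x y)%:E + (mdist y (\val g y))%:E))%E).
  apply: ge0_le_integral => //.
  move=> g _; rewrite /h -EFinD lee_fin ger0_norm ?mdist_ge0//.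
  have e1 := metric_triangle x y (\val g x).
  have e2 := metric_triangle y (\val g y) (\val g x).
  rewrite isometry_mdist (metric_sym y x) in e2; lra.
rewrite ge0_integralD//; last 2 first.
- by move=> g _; rewrite lee_fin mulr_ge0 ?mdist_ge0.
- by move=> g _; rewrite lee_fin mdist_ge0.
rewrite integral_cst// lte_add_pinfty//.
by rewrite [X in (_ * X)%E]probability_setT mule1 ltry.
Qed.

Lemma integrable_displacement n : P.-integrable setT (EFin \o displacement n).
Proof.
elim: n => [|n IH].
  apply: (eq_integrable measurableT (cst 0%E)) => [w _|]; last exact: integrable0.
  by rewrite /= displacement0.
apply: (le_integrable measurableT (f := EFin \o displacement n.+1)
  (g := (EFin \o displacement 1) \+ (EFin \o (displacement n \o path_shift 1)))%E).
- by apply/measurable_EFinP; exact: measurable_displacement.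
- move=> w _; rewrite /= lee_fin ger0_norm ?displacement_ge0//.
  by rewrite ger0_norm ?addr_ge0 ?displacement_ge0//; rewrite -add1n; exact: displacementD.
- apply: integrableD => //; first exact: integrable_displacement1.
  exact: (integrable_preserved (measurable_path_shift 1) (path_shift_preserves muP 1) IH).
Qed.

Definition mean_displacement n : R := \int[P]_w displacement n w.

(** The rate of escape: for an integrable walk, Fekete's lemma identifies this infimum with the
    limit of the means. Time 0 is left out, as its rate 0 / 0 is 0 by convention and would make the
    infimum vanish. *)
Definition drift : R := inf [set mean_displacement n.+1 / n.+1%:R | n in [set: nat]].

Lemma mean_displacement_ge0 n : 0 <= mean_displacement n.
Proof. by apply: Rintegral_ge0 => w _; exact: displacement_ge0. Qed.

Let rates_lbound : lbound [set mean_displacement n.+1 / n.+1%:R | n in [set: nat]] 0.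
Proof. by move=> _ [n _ <-]; rewrite divr_ge0// mean_displacement_ge0. Qed.

Lemma drift_ge0 : 0 <= drift.
Proof. by apply: lb_le_inf => //; exists (mean_displacement 1 / 1%:R), 0%N. Qed.

Lemma drift_le n : drift * n%:R <= mean_displacement n.
Proof.
case: n => [|n]; first by rewrite mulr0 mean_displacement_ge0.
rewrite -ler_pdivlMr//; apply: ge_inf; first by exists 0.
by exists n.
Qed.

Lemma drift_lt (alpha : R) : drift < alpha ->
  exists m, (0 < m)%N /\ mean_displacement m < alpha * m%:R.
Proof.
move=> /inf_lt[|_ [n _ <-] h].
  by exists (mean_displacement 1 / 1%:R), 0%N.
by exists n.+1; split => //; rewrite -ltr_pdivrMr.
Qed.

Lemma ae_path_shift r (Q : path_space (gelt G) -> Prop) :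
  {ae P, forall w, Q w} -> {ae P, forall w, Q (path_shift r w)}.
Proof.
move=> [N [mN PN0 hN]]; exists (path_shift r @^-1` N); split.
- by rewrite -[X in measurable X]setTI; exact: measurable_path_shift.
- by rewrite (path_shift_preserves muP).
- by move=> w hw; apply: hN.
Qed.

(* Here [b] is additive, so that infinitely many leaders force [b k >= 0] for all
   [k]; this takes the place of the law of large numbers. *)
Lemma displacement_multiples m (alpha : R) : (0 < m)%N ->
  mean_displacement m < alpha * m%:R ->
  {ae P, forall w, exists j, forall k,
    displacement (k * m) (path_shift (j * m) w) <= alpha * (k * m)%:R}.
Proof.
move=> m0 hm; pose S : path_space (gelt G) -> path_space (gelt G) := path_shift m.
have mS : measurable_fun setT S := measurable_path_shift m.
have PS := path_shift_preserves muP m.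
pose f w := alpha * m%:R - displacement m w.
have ci : P.-integrable setT (EFin \o cst (alpha * m%:R)).
  exact: finite_measure_integrable_cst.
have fi : P.-integrable setT (EFin \o f).
  exact: (integrableB measurableT ci (integrable_displacement m)).
have Ef : \int[P]_w f w = alpha * m%:R - mean_displacement m.
  rewrite RintegralB//; last exact: integrable_displacement.
  by rewrite /Rintegral integral_cst// [X in (_ * X)%E]probability_setT mule1.
pose b n w := \sum_(i < n) f (iter i S w).
have hi i : P.-integrable setT (EFin \o (fun w => f (iter i S w))).
  exact: (integrable_preserved (measurable_iter mS i) (iter_preserves mS PS i) fi).
have bi n : P.-integrable setT (EFin \o b n) := (Rintegral_sum_nat n hi).1.
have bD k l w : b (k + l)%N w = b k w + b l (iter k S w).
  rewrite /b big_split_ord /=; congr (_ + _); apply: eq_bigr => i _.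
  by rewrite -iterD addnC.
have b0 w : b 0%N w = 0 by rewrite /b big_ord0.
have bS n w : b n.+1 w <= f w + b n (S w).
  by rewrite -add1n bD /b big_ord1.
have Eb n : (alpha * m%:R - mean_displacement m) * n%:R <= \int[P]_w b n w.
  rewrite (Rintegral_sum_nat n hi).2 (eq_bigr (fun=> alpha * m%:R - mean_displacement m)).
    by rewrite sumr_const card_ord mulr_natr.
  move=> i _; rewrite (Rintegral_preserved (measurable_iter mS i) (iter_preserves mS PS i) fi).
  exact: Ef.
have B0 : 0 < alpha * m%:R - mean_displacement m by rewrite subr_gt0.
have Ppos := leader_io_gt0 mS PS bi fi b0 bS B0 Eb.
have mL : measurable (lim_sup_set (leader S b)).
  apply: bigcapT_measurable => n; apply: bigcup_measurable => k _.
  exact: (measurable_leader mS bi).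
apply: filterS (path_shift_ergodic muP m0 mL Ppos) => w [j hj]; exists j => k.
set w' := path_shift (j * m) w in hj *.
(* For a leader [n >= k], the leader inequality at [k] compares [b n w'] with its own tail; by
   additivity the difference is [b k w']. *)
have bk : 0 <= b k w'.
  have [n /= kn /(_ k kn)] := hj k I.
  by rewrite -{2}(subnKC kn) bD lerDr.
have dk l v : displacement (l * m) v <= \sum_(i < l) displacement m (iter i S v).
  elim: l v => [|l IH] v; first by rewrite mul0n displacement0 big_ord0.
  rewrite mulSn big_ord_recl; apply: le_trans (displacementD _ _ _) _.
  rewrite lerD2l; apply: le_trans (IH _) _; apply: ler_sum => i _.
  by rewrite -iterSr.
apply: le_trans (dk k w') _; rewrite -subr_ge0.
move: bk; rewrite /b /f sumrB sumr_const card_ord.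
by rewrite -[_ *+ k]mulr_natr -mulrA -natrM (mulnC m).
Qed.

(** [displacement_multiples] only sees blocks of length [m] after some time [j * m]. It is applied
    to the path shifted by each residue [r], and a time [n] of residue [r] is split as r + j m plus
    whole blocks. The displacement [C] up to r + j m does not depend on [n], so half of [e] absorbs
    it. *)
Lemma displacement_upper (e : R) : 0 < e ->
  {ae P, forall w, exists K, forall k, (K <= k)%N -> displacement k w <= (drift + e) * k%:R}.
Proof.
move=> e0; have [m [m0 hm]] : exists m, (0 < m)%N /\
    mean_displacement m < (drift + e / 2) * m%:R by apply: drift_lt; lra.
have hall := fun r => ae_path_shift r (displacement_multiples m0 hm).
apply: filterS (ae_foralln hall) => w hw.
have alpha0 : 0 <= drift + e / 2 by have := drift_ge0; lra.
have /choice[K hK] : forall r, exists K, forall n, (K <= n)%N -> (n %% m)%N = r ->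
    displacement n w <= (drift + e) * n%:R.
  move=> r; have [j hj] := hw r.
  pose C := displacement (r + j * m) w.
  have C0 : 0 <= C := displacement_ge0 _ _.
  exists (maxn (Num.bound (C / (e / 2))) ((j + 1) * m)) => n.
  rewrite geq_max => /andP[nC nj] nr.
  have nE : n = (r + j * m + (n %/ m - j) * m)%N.
    have jn : (j <= n %/ m)%N by rewrite leq_divRL// (leq_trans _ nj)// leq_mul2r leq_addr orbT.
    by rewrite -addnA -mulnDl subnKC// addnC -nr -divn_eq.
  have Cn : C <= e / 2 * n%:R.
    rewrite -ler_pdivrMl; last by lra.
    rewrite mulrC; apply: le_trans (ltW (archi_boundP _)) _; last by rewrite ler_nat.
    by rewrite divr_ge0//; lra.
  have h1 := hj (n %/ m - j)%N; rewrite path_shiftD in h1.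
  have h2 := displacementD (r + j * m) ((n %/ m - j) * m) w; rewrite -nE -/C in h2.
  have h3 : (drift + e / 2) * ((n %/ m - j) * m)%:R <= (drift + e / 2) * n%:R.
    by apply: ler_wpM2l => //; rewrite ler_nat [leqRHS]nE leq_addl.
  lra.
exists (\max_(r < m) K r) => n hn.
apply: (hK (n %% m)%N) => //; apply: leq_trans hn.
exact: (leq_bigmax (F := fun r : 'I_m => K r) (Ordinal (ltn_pmod n m0))).
Qed.

(** A leader [n] of [b] for the path shifted by [j] gives the bound at the time j + n of the
    original path, with slope [c] and an error [C] due to the first [j] steps. That error is at most
    [e / 2 * k%:R] once [k] is large, which uses up the other half of [e]. *)
Lemma displacement_lower (e : R) : 0 < e ->
  {ae P, forall w, exists K, forall N, exists2 n, (N <= n)%N &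
     forall k, (K <= k <= n)%N ->
       (drift - e) * k%:R <= displacement n w - displacement (n - k) (path_shift k w)}.
Proof.
move=> e0; pose c := drift - e / 2.
pose S : path_space (gelt G) -> path_space (gelt G) := path_shift 1.
have mS : measurable_fun setT S := measurable_path_shift 1.
have PS := path_shift_preserves muP 1.
pose b n w := displacement n w - c * n%:R.
pose f w := displacement 1 w - c.
have ci a : P.-integrable setT (EFin \o cst a).
  exact: finite_measure_integrable_cst.
have fi : P.-integrable setT (EFin \o f).
  exact: (integrableB measurableT (integrable_displacement 1) (ci c)).
have bi n : P.-integrable setT (EFin \o b n).
  exact: (integrableB measurableT (integrable_displacement n) (ci (c * n%:R))).
have b0 w : b 0%N w = 0 by rewrite /b displacement0 mulr0 subr0.
have bS n w : b n.+1 w <= f w + b n (S w).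
  have := displacementD 1 n w.
  by rewrite /b /f -/S add1n -[n.+1]add1n natrD mulrDr mulr1; lra.
have Eb n : e / 2 * n%:R <= \int[P]_w b n w.
  rewrite RintegralB//; [|exact: integrable_displacement|exact: ci].
  have -> : \int[P]_w (c * n%:R) = c * n%:R.
    by rewrite /Rintegral integral_cst// [X in (_ * X)%E]probability_setT mule1.
  by have := drift_le n; rewrite -/(mean_displacement n) /c mulrBl; lra.
have B0 : 0 < e / 2 by lra.
have Ppos := leader_io_gt0 mS PS bi fi b0 bS B0 Eb.
have mL : measurable (lim_sup_set (leader S b)).
  apply: bigcapT_measurable => n; apply: bigcup_measurable => k _.
  exact: (measurable_leader mS bi).
apply: filterS (path_shift_ergodic muP (ltnSn 0) mL Ppos) => w [j].
rewrite muln1 => hj.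
(* The absolute value is there because [c] is negative when the drift is less than [e / 2]. *)
pose C := displacement j w + `|c| * j%:R.
have C0 : 0 <= C by rewrite addr_ge0 ?displacement_ge0// mulr_ge0.
exists (maxn j (Num.bound (C / (e / 2)))) => N.
have [n /= Nn hn] := hj N I.
exists (j + n)%N => [|k]; first exact: leq_trans (leq_addl _ _).
rewrite geq_max => /andP[/andP[jk Ck] kn].
have kjn : (k - j <= n)%N by rewrite leq_subLR.
have := hn _ kjn; rewrite iter_path_shift muln1 path_shiftD subnKC//.
rewrite (_ : n - (k - j) = j + n - k)%N; last by lia.
rewrite /b; have -> : (j + n - k)%N%:R = n%:R - (k%:R - j%:R) :> R.
  by rewrite -natrB// -natrB//; congr (_%:R); lia.
move=> h1; have h2 := displacement_shift j n w.
have Cn : C <= e / 2 * k%:R.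
  rewrite -ler_pdivrMl; last by lra.
  rewrite mulrC; apply: le_trans (ltW (archi_boundP _)) _; last by rewrite ler_nat.
  by rewrite divr_ge0//; lra.
have h3 : c * j%:R <= `|c| * j%:R by rewrite ler_wpM2r// ler_norm.
by move: Cn h1; rewrite /C /c in h3 *; lra.
Qed.

End Drift.
End Displacement.

(** * From the almost sure bounds to the tracking ray *)

Lemma small_invS (R : realType) (e : R) : 0 < e -> exists i : nat, i.+1%:R^-1 <= e.
Proof.
move=> e0; exists (Num.bound e^-1); rewrite invf_ple ?posrE ?ltr0n//.
by rewrite (le_trans (ltW (archi_boundP _))) ?invr_ge0 ?(ltW e0)// ler_nat.
Qed.

Unset Implicit Arguments.

Theorem theorem24 (R : realType) (X : metricType R) (x : X)
  (G : isometry_group X) (mu : probability (gelt G) R)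
  (P : probability (path_space (gelt G)) R) :
  hadamard X ->
  locally_compact [set: X] ->
  rank_one X ->
  (exists xi1 xi2 xi3 : boundary X,
     [/\ xi1 <> xi2, xi1 <> xi3 & xi2 <> xi3]) ->
  countable (isometries G) ->
  duality_condition G ->
  support_generates_semigroup mu ->
  finite_first_moment mu ->
  is_product_measure mu P ->
  exists2 A : R, 0 <= A &
    {ae P, forall omega, exists gamma : ray X,
       gamma 0 = x /\
       mdist (walk omega n x) (gamma (A * n%:R)) / n%:R @[n --> \oo] --> (0 : R)}.
Proof.
move=> [_ hc hG hC] _ [sigma _] _ cG _ _ hmom muP.
exists (drift x P); first exact: drift_ge0.
have inv0 (i : nat) : 0 < i.+1%:R^-1 :> R by rewrite invr_gt0 ltr0n.
(* Only the precisions 1 / (i + 1) are used: a countable union of exceptional null sets is null. *)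
have hu := ae_foralln (fun i => displacement_upper x cG muP hmom (inv0 i)).
have hl := ae_foralln (fun i => displacement_lower x cG muP hmom (inv0 i)).
apply: filterS2 hu hl => w hu hl.
have up (e : R) : 0 < e -> exists K, forall k, (K <= k)%N ->
    mdist x (walk w k x) <= (drift x P + e) * k%:R.
  move=> /small_invS[i ie]; have [K hK] := hu i; exists K => k Kk.
  by apply: le_trans (hK k Kk) _; rewrite ler_wpM2r// lerD2l.
have := drift_ge0 x P; rewrite le_eqVlt => /orP[/eqP A0|Apos].
  (* When the drift is 0 the ray is evaluated at time 0 only, where it equals [x]. *)
  have [gamma g0] := exists_ray_from x sigma hC hG hc.
  exists gamma; split => //; apply/cvgrPdist_le => e e0.
  have [K hK] := up e e0; exists K.+1 => // n /= Kn.
  rewrite -A0 mul0r g0 sub0r normrN ger0_norm ?divr_ge0 ?mdist_ge0//.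
  rewrite ler_pdivrMr; last by rewrite ltr0n; exact: leq_trans Kn.
  by have := hK n (ltnW Kn); rewrite -A0 add0r metric_sym.
apply: sublinear_tracking => // e /small_invS[i ie].
have [K hK] := hl i; exists K => N; have [n Nn hn] := hK N; exists n => // k hk.
have := hn k hk; rewrite -mdist_walk subnKC; last by case/andP: hk.
by apply: le_trans; rewrite ler_wpM2r// lerD2l lerN2.
Qed.
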